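(* Let $\mathcal{G}$ be a Hausdorff ample groupoid and let $S$ be a commutative semiring. The Steinberg algebra $A_S(\mathcal{G})$ is congruence-simple if and only if the following two conditions are satisfied: (1) $S$ is either a field or (isomorphic to) the Boolean semifield $\mathbb{B}$; (2) $\mathcal{G}$ is both minimal and effective.
   Context: Semirings. A hemiring is $(S,+,\cdot,0)$ with $(S,+,0)$ a commutative monoid, $(S,\cdot)$ a semigroup, multiplication distributing over addition on both sides, and $0s=0=s0$ for all $s$. A semiring is a hemiring with a multiplicative identity $1\neq 0$; it is commutative if its multiplication is. The Boolean semifield is $\mathbb{B}=(\{0,1\},\vee,\wedge,0,1)$. A congruence on a hemiring $S$ is an equivalence relation $\rho$ such that $(a,b)\in\rho$ and $s\in S$ imply $(s+a,s+b),(sa,sb),(as,bs)\in\rho$. A nonzero hemiring $S$ is congruence-simple if its only congruences are the diagonal $\{(s,s)\mid s\in S\}$ and the universal congruence $S\times S$. Since congruence-simpleness is defined for nonzero hemirings only, the groupoid $\mathcal{G}$ is understood to be nonempty. Groupoids. A groupoid $\mathcal{G}$ is a small category in which every morphism is invertible, identified with its set of morphisms; $s(\alpha)=\alpha^{-1}\alpha$, $r(\alpha)=\alpha\alpha^{-1}$, a product $\alpha\beta$ is defined iff $r(\beta)=s(\alpha)$, and $\mathcal{G}^{(0)}=s(\mathcal{G})=r(\mathcal{G})$ is the unit space. A topological groupoid is a groupoid with a topology for which inversion and composition are continuous (composition on the set of composable pairs with the relative product topology). It is étale if $\mathcal{G}^{(0)}$ is locally compact Hausdorff and $s$ is a local homeomorphism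 (then $\mathcal{G}^{(0)}$ is open in $\mathcal{G}$). An open bisection is an open set $U\subseteq\mathcal{G}$ such that $s|_U$ and $r|_U$ are homeomorphisms onto open subsets of $\mathcal{G}^{(0)}$. An étale groupoid is ample if it has a base of compact open bisections. A subset $D\subseteq\mathcal{G}^{(0)}$ is invariant if $s(\gamma)\in D$ implies $r(\gamma)\in D$ for all $\gamma\in\mathcal{G}$. $\mathcal{G}$ is minimal if $\mathcal{G}^{(0)}$ has no open invariant subsets other than $\varnothing$ and $\mathcal{G}^{(0)}$. With $\mathrm{Iso}(\mathcal{G})=\{\gamma\mid s(\gamma)=r(\gamma)\}$, $\mathcal{G}$ is effective if the interior of $\mathrm{Iso}(\mathcal{G})\setminus\mathcal{G}^{(0)}$ is empty. Steinberg algebra. For a Hausdorff ample groupoid $\mathcal{G}$ and a commutative semiring $S$ with the discrete topology, $A_S(\mathcal{G})$ is the $S$-subsemimodule of the semimodule of continuous functions $\mathcal{G}\to S$ (pointwise operations) generated by the characteristic functions $1_U$ of compact open bisections $U$, with convolution product $(f*g)(\gamma)=\sum_{\gamma=\alpha\beta} f(\alpha)g(\beta)$ (sum over composable pairs). *)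

(* Defs.v *)
From HB Require Import structures.
From mathcomp Require Import all_boot all_order all_algebra.
From mathcomp Require Import all_classical.
From mathcomp Require Import topology.

Set Implicit Arguments.
Unset Strict Implicit.
Unset Printing Implicit Defensive.

Import GRing.Theory.
Local Open Scope classical_set_scope.
Local Open Scope ring_scope.

(* The multiplication of a hemiring is the (non-unital) semigroup law [*%g]. *)
HB.mixin Record Nmodule_Semigroup_isHemiring R
    of GRing.Nmodule R & Semigroup R := {
  hemi_mulDl : forall a b c : R, ((a + b)%R * c)%g = (a * c)%g + (b * c)%g;
  hemi_mulDr : forall a b c : R, (a * (b + c)%R)%g = (a * b)%g + (a * c)%g;
  hemi_mul0l : forall a : R, ((0%R : R) * a)%g = 0;
  hemi_mul0r : forall a : R, (a * (0%R : R))%g = 0;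
}.

#[short(type="hemiringType")]
HB.structure Definition Hemiring :=
  { R of GRing.Nmodule R & Semigroup R & Nmodule_Semigroup_isHemiring R }.

Record congruence (R : hemiringType) (rho : R -> R -> Prop) : Prop := {
  congruence_refl : forall a, rho a a;
  congruence_sym : forall a b, rho a b -> rho b a;
  congruence_trans : forall a b c, rho a b -> rho b c -> rho a c;
  congruence_add : forall s a b, rho a b -> rho (s + a) (s + b);
  congruence_mull : forall s a b, rho a b -> rho (s * a)%g (s * b)%g;
  congruence_mulr : forall s a b, rho a b -> rho (a * s)%g (b * s)%g;
}.

Definition congruence_simple (R : hemiringType) : Prop :=
  (exists x : R, x <> 0) /\
  forall rho : R -> R -> Prop, congruence rho ->
    (forall a b, rho a b <-> a = b) \/ (forall a b, rho a b).

Definition is_field (S : comNzSemiRingType) : Prop :=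
  (forall x : S, exists y, x + y = 0) /\
  (forall x : S, x <> 0 -> exists y, x * y = 1).

(* An alias, because the library equips [bool] with the field structure whose
   addition is exclusive or. *)
Definition boolean_semifield : Type := bool.
HB.instance Definition _ := Choice.on boolean_semifield.
HB.instance Definition _ :=
  GRing.isNmodule.Build boolean_semifield orbA orbC orFb.
HB.instance Definition _ :=
  GRing.Nmodule_isComNzSemiRing.Build boolean_semifield
    andbA andbC andTb andb_orl andFb isT.

Definition is_boolean_semifield (S : comNzSemiRingType) : Prop :=
  exists phi : {rmorphism S -> boolean_semifield}, bijective phi.

(* A small category with all arrows invertible, on its set of arrows: an object
   is identified with its identity arrow, so source and range are endomaps of
   [G].  Composition is a total function whose values are only meaningful (and
   only constrained) on composable pairs. *)
HB.mixin Record isGroupoid G := {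
  src : G -> G;
  rng : G -> G;
  gmul : G -> G -> G;
  ginv : G -> G;
  rng_src : forall a, rng (src a) = src a;
  src_rng : forall a, src (rng a) = rng a;
  src_mul : forall a b, src a = rng b -> src (gmul a b) = src b;
  rng_mul : forall a b, src a = rng b -> rng (gmul a b) = rng a;
  gmulA : forall a b c, src a = rng b -> src b = rng c ->
    gmul a (gmul b c) = gmul (gmul a b) c;
  gmul_src : forall a, gmul a (src a) = a;
  gmul_rng : forall a, gmul (rng a) a = a;
  src_inv : forall a, src (ginv a) = rng a;
  rng_inv : forall a, rng (ginv a) = src a;
  gmulVg : forall a, gmul (ginv a) a = src a;
  gmulgV : forall a, gmul a (ginv a) = rng a;
}.

#[short(type="groupoidType")]
HB.structure Definition Groupoid := { G of isGroupoid G }.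

Definition composable (G : groupoidType) : set (G * G) :=
  [set ab | src ab.1 = rng ab.2].
Arguments composable : clear implicits.

Definition units (G : groupoidType) : set G := range src.
Arguments units : clear implicits.

Definition iso (G : groupoidType) : set G := [set a | src a = rng a].
Arguments iso : clear implicits.

Lemma units_src (G : groupoidType) (a : G) : src a \in units G.
Proof. by apply/mem_set; exists a. Qed.

Lemma units_rng (G : groupoidType) (a : G) : rng a \in units G.
Proof. by apply/mem_set; exists (ginv a) => //; rewrite src_inv. Qed.

(* Source and range with values in the unit space [units G], seen as a type;
   for a topological groupoid this type carries the subspace topology. *)
Definition usrc (G : groupoidType) (a : G) : units G :=
  exist (fun x => x \in units G) (src a) (units_src a).
Definition urng (G : groupoidType) (a : G) : units G :=
  exist (fun x => x \in units G) (rng a) (units_rng a).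

HB.mixin Record isTopologicalGroupoid G of Topological G & Groupoid G := {
  ginv_continuous : continuous (ginv : G -> G);
  gmul_continuous : {within composable G,
    continuous (fun ab : G * G => gmul ab.1 ab.2)};
}.

#[short(type="topologicalGroupoidType")]
HB.structure Definition TopologicalGroupoid :=
  { G of Topological G & Groupoid G & isTopologicalGroupoid G }.

(* [f] restricts to a homeomorphism from [U] onto an open subset of [Y]. *)
Definition homeo_onto_open (X Y : topologicalType) (U : set X) (f : X -> Y) :=
  [/\ {within U, continuous f}, open (f @` U) &
      exists g : Y -> X, {in U, cancel f g} /\ {within f @` U, continuous g}].

Definition local_homeo (X Y : topologicalType) (f : X -> Y) :=
  forall x, exists U : set X, open_nbhs x U /\ homeo_onto_open U f.

Definition etale (G : topologicalGroupoidType) : Prop :=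
  [/\ locally_compact [set: units G], hausdorff_space (units G)
    & local_homeo (@usrc G)].

Definition open_bisection (G : topologicalGroupoidType) (U : set G) : Prop :=
  [/\ open U, homeo_onto_open U (@usrc G) & homeo_onto_open U (@urng G)].

Definition compact_open_bisections (G : topologicalGroupoidType) :
  set (set G) := [set U | open_bisection U /\ compact U].
Arguments compact_open_bisections : clear implicits.

Definition ample (G : topologicalGroupoidType) : Prop :=
  etale G /\ basis (compact_open_bisections G).

HB.mixin Record isHausdorffAmple G of TopologicalGroupoid G := {
  groupoid_hausdorff : hausdorff_space G;
  groupoid_ample : ample G;
}.

#[short(type="hausdorffAmpleGroupoidType")]
HB.structure Definition HausdorffAmpleGroupoid :=
  { G of TopologicalGroupoid G & isHausdorffAmple G }.

Definition invariant (G : groupoidType) (D : set (units G)) : Prop :=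
  forall a : G, D (usrc a) -> D (urng a).

Definition minimal (G : topologicalGroupoidType) : Prop :=
  forall D : set (units G), open D -> invariant D -> D = set0 \/ D = setT.

Definition effective (G : topologicalGroupoidType) : Prop :=
  interior (iso G `\` units G) = set0.

Definition charfun (T : Type) (S : comNzSemiRingType) (U : set T) : T -> S :=
  fun x => if x \in U then 1 else 0.

Definition subsemimodule (T : Type) (S : comNzSemiRingType)
    (M : set (T -> S)) : Prop :=
  [/\ M 0, forall f g, M f -> M g -> M (f + g)
    & forall (c : S) f, M f -> M (fun x => c * f x)].

(* The functions that belong to the Steinberg algebra; they are continuous for
   the discrete topology on [S], see [steinberg_continuous]. *)
Definition steinberg_set (G : topologicalGroupoidType)
    (S : comNzSemiRingType) : set (G -> S) :=
  smallest (@subsemimodule G S)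
    [set charfun S U | U in compact_open_bisections G].
Arguments steinberg_set : clear implicits.

Definition convolution (G : topologicalGroupoidType) (S : comNzSemiRingType)
    (f g : G -> S) : G -> S :=
  fun c => \sum_(ab \in [set ab : G * G |
                         composable G ab /\ gmul ab.1 ab.2 = c]) f ab.1 * g ab.2.

Section GroupoidTheory.
Variable G : groupoidType.
Implicit Types a b c : G.

Lemma src_src a : src (src a) = src a.
Proof. by rewrite -{1}[src a]rng_src src_rng rng_src. Qed.

Lemma rng_rng a : rng (rng a) = rng a.
Proof. by rewrite -{1}[rng a]src_rng rng_src src_rng. Qed.

Lemma gmulKV a b : src a = rng b -> gmul (ginv a) (gmul a b) = b.
Proof. by move=> ab; rewrite gmulA ?src_inv// gmulVg ab gmul_rng. Qed.

Lemma gmulVK a b : rng a = rng b -> gmul a (gmul (ginv a) b) = b.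
Proof. by move=> ab; rewrite gmulA ?rng_inv ?src_inv// gmulgV ab gmul_rng. Qed.

Lemma gmulI a b c : src a = rng b -> src a = rng c ->
  gmul a b = gmul a c -> b = c.
Proof. by move=> ab ac e; rewrite -(gmulKV ab) e gmulKV. Qed.

Lemma usrcP a b : usrc a = usrc b <-> src a = src b.
Proof.
by split=> [/(congr1 val)//|e]; apply: val_inj.
Qed.

Lemma urngP a b : urng a = urng b <-> rng a = rng b.
Proof.
by split=> [/(congr1 val)//|e]; apply: val_inj.
Qed.

Definition set_mul (U V : set G) : set G :=
  [set c | exists a b, [/\ U a, V b, src a = rng b & c = gmul a b]].

Lemma set_mulA U V W : set_mul (set_mul U V) W = set_mul U (set_mul V W).
Proof.
apply/seteqP; split=> c.
  move=> [_ [w [[u [v [Uu Vv uv ->]]] Ww]]]; rewrite src_mul// => vw ->.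
  exists u, (gmul v w); split; [by []|by exists v, w| |by rewrite gmulA].
  by rewrite rng_mul.
move=> [u [_ [Uu [v [w [Vv Ww vw ->]]]]]]; rewrite rng_mul// => uv ->.
exists (gmul u v), w; split; [by exists u, v|by []| |by rewrite gmulA].
by rewrite src_mul.
Qed.

End GroupoidTheory.

Section HomeoTheory.
Variables X Y : topologicalType.
Implicit Types (f : X -> Y) (U W : set X).

Lemma homeo_inj U f : homeo_onto_open U f -> {in U &, injective f}.
Proof. by move=> [_ _ [g [fK _]]]; exact: can_in_inj fK. Qed.

Lemma homeo_open_image U W f : homeo_onto_open U f -> open W -> W `<=` U ->
  open (f @` W).
Proof.
move=> [_ ofU [g [fK cg]]] oW WU.
have -> : f @` W = f @` U `&` g @^-1` W.
  apply/seteqP; split=> y /=.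
    move=> [x Wx <-]; split; first by exists x => //; exact: WU.
    by rewrite fK// inE; exact: WU.
  by move=> [[x Ux <-]]; rewrite fK ?inE// => Wx; exists x.
by rewrite continuous_open_subspace// in cg; exact: (continuous_inP _ ofU).1.
Qed.

Lemma homeo_intro U f (h : Y -> X) : continuous f ->
  (forall W, open W -> open (f @` W)) -> open U -> {in U &, injective f} ->
  homeo_onto_open U f.
Proof.
move=> cf fo oU If; split; [exact: continuous_subspaceT|exact: fo|].
pose g y := if pselect (exists2 x, U x & f x = y) is left e
            then xget (h y) [set x | U x /\ f x = y] else h y.
have fK : {in U, cancel f g}.
  move=> x /set_mem Ux; rewrite /g; case: pselect => [e|[]]; last by exists x.
  case: xgetP => [z _ [Uz fz]|/(_ x) []//]; first by apply: If; rewrite ?inE.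
exists g; split=> //; rewrite continuous_open_subspace//; last exact: fo.
apply/continuous_inP => [|W oW]; first exact: fo.
have -> : f @` U `&` g @^-1` W = f @` (U `&` W).
  apply/seteqP; split=> y /=.
    by move=> [[x Ux <-]]; rewrite fK ?inE// => Wx; exists x.
  by move=> [x [Ux Wx] <-]; rewrite fK ?inE//; split=> //; exists x.
exact/fo/openI.
Qed.

Lemma local_homeo_continuous f : local_homeo f -> continuous f.
Proof.
move=> lf x; have [U [[oU Ux] [cf _ _]]] := lf x.
rewrite continuous_open_subspace// in cf; apply: cf; exact/mem_set.
Qed.

Lemma local_homeo_open f W : local_homeo f -> open W -> open (f @` W).
Proof.
move=> lf oW; rewrite openE => _ [x Wx <-].
have [U [[oU Ux] hU]] := lf x; rewrite /interior nbhsE /=.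
exists (f @` (W `&` U)); last by apply: image_subset => ? [].
split; last by exists x.
by apply: (homeo_open_image hU); [exact: openI|exact: subIsetr].
Qed.

End HomeoTheory.

Section AmpleTheory.
Variable G : hausdorffAmpleGroupoidType.
Implicit Types (U V : set G).

Lemma usrc_local_homeo : local_homeo (@usrc G).
Proof. by case: (@groupoid_ample G) => -[]. Qed.

Lemma usrc_continuous : continuous (@usrc G).
Proof. exact: local_homeo_continuous usrc_local_homeo. Qed.

Lemma urngE : @urng G = @usrc G \o ginv.
Proof. by apply/funext => a; apply: val_inj; rewrite /= src_inv. Qed.

Lemma urng_continuous : continuous (@urng G).
Proof.
rewrite urngE => a; apply: continuous_comp; first exact: ginv_continuous.
exact: usrc_continuous.
Qed.

Lemma ginvK : involutive (@ginv G).
Proof.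
move=> a; apply: (@gmulI _ (ginv a)); rewrite ?rng_inv ?src_inv//.
by rewrite gmulgV gmulVg rng_inv.
Qed.

Lemma usrc_open (W : set G) : open W -> open (@usrc G @` W).
Proof. exact: local_homeo_open usrc_local_homeo. Qed.

Lemma urng_open (W : set G) : open W -> open (@urng G @` W).
Proof.
move=> oW; rewrite urngE -image_comp; apply: usrc_open.
have -> : ginv @` W = ginv @^-1` W.
  apply/seteqP; split=> x; first by move=> [y Wy <-]; rewrite /= ginvK.
  by move=> Wx; exists (ginv x); rewrite ?ginvK.
by have /continuousP := @ginv_continuous G; apply.
Qed.

Lemma open_bisection_intro U : open U ->
  {in U &, injective (@usrc G)} -> {in U &, injective (@urng G)} ->
  open_bisection U.
Proof.
move=> oU Is Ir; split=> //.
- by apply: (homeo_intro (fun u : units G => val u)) => //;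
  [exact: usrc_continuous|exact: usrc_open].
- by apply: (homeo_intro (fun u : units G => val u)) => //;
  [exact: urng_continuous|exact: urng_open].
Qed.

Lemma bisection_srcI U a b : open_bisection U -> U a -> U b ->
  src a = src b -> a = b.
Proof.
by move=> [_ /homeo_inj I _] Ua Ub /usrcP; apply: I; rewrite inE.
Qed.

Lemma bisection_rngI U a b : open_bisection U -> U a -> U b ->
  rng a = rng b -> a = b.
Proof.
by move=> [_ _ /homeo_inj I] Ua Ub /urngP; apply: I; rewrite inE.
Qed.

Lemma units_hausdorff : hausdorff_space (units G).
Proof. by case: (@groupoid_ample G) => -[]. Qed.

Lemma composable_closed : closed (composable G).
Proof.
rewrite -[composable G]setCK closedC openE => -[a b] /= /eqP nab.
have : usrc a != urng b by apply: contra_neq nab => /(congr1 val).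
have := units_hausdorff; rewrite open_hausdorff => /[apply].
move=> [[A B] /= [/set_mem Aa /set_mem Bb] [oA oB /eqP AB0]].
exists (@usrc G @^-1` A, @urng G @^-1` B).
  split; [apply: usrc_continuous|apply: urng_continuous];
    exact: open_nbhs_nbhs.
move=> [a' b'] /= [Aa' Bb'] e.
have e' : usrc a' = urng b' by apply: val_inj.
have : (A `&` B) (usrc a') by split; [exact: Aa'|rewrite e'; exact: Bb'].
by rewrite AB0.
Qed.

Lemma set_mul_compact U V : compact U -> compact V -> compact (set_mul U V).
Proof.
move=> cU cV.
have -> : set_mul U V =
    (fun ab => gmul ab.1 ab.2) @` (U `*` V `&` composable G).
  apply/seteqP; split=> c.
    by move=> [a [b [Ua Vb ab ->]]]; exists (a, b).
  by move=> [[a b] /= [[Ua Vb] ab] <-]; exists a, b.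
apply: continuous_compact; last first.
  by apply: compact_closedI composable_closed; exact: compact_setX.
apply: (@continuous_subspaceW _ _ _ (composable G)) gmul_continuous.
exact: subIsetr.
Qed.

Lemma set_mul_open U V : open_bisection U -> open V -> open (set_mul U V).
Proof.
move=> bU oV; have [oU _ hr] := bU; have [_ orU [g [rK cg]]] := hr.
rewrite openE => _ [a0 [b0 [Ua0 Vb0 ab0 ->]]].
set c0 := gmul a0 b0.
have c0U : (@urng G @` U) (urng c0).
  by exists a0 => //; apply/urngP; rewrite rng_mul.
have W_nbhs : nbhs c0 (@urng G @^-1` (@urng G @` U)).
  by apply: urng_continuous; exact: open_nbhs_nbhs.
have gP c : (@urng G @` U) (urng c) -> U (g (urng c)) /\ rng (g (urng c)) = rng c.
  by move=> [a Ua rac]; rewrite -rac rK ?inE//; split=> //; exact/urngP.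
pose h c := (ginv (g (urng c)), c).
have h_cvg : h c @[c --> c0] --> within (composable G) (nbhs (h c0)).
  have ch : h c @[c --> c0] --> nbhs (h c0).
    apply: cvg_pair; last exact: cvg_id.
    apply: (@continuous_comp _ _ _ (fun c => g (urng c)) ginv); last first.
      exact: ginv_continuous.
    apply: (@continuous_comp _ _ _ (@urng G) g); first exact: urng_continuous.
    by rewrite continuous_open_subspace// in cg; apply: cg; exact/mem_set.
  move=> P /ch; rewrite /nbhs /= /within /= => hP.
  near=> c.
  have : composable G (h c) -> P (h c) by near: c; exact: hP.
  apply; rewrite /composable /= src_inv.
  by have [|//] := gP c _; near: c.
have hc0 : gmul (h c0).1 (h c0).2 = b0.
  have [Ug rg] := gP _ c0U.
  have -> : h c0 = (ginv a0, c0).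
    congr (ginv _, _); apply: (bisection_rngI bU) => //.
    by rewrite rg rng_mul.
  exact: gmulKV.
have : gmul (h c).1 (h c).2 @[c --> c0] --> gmul (h c0).1 (h c0).2.
  apply: cvg_trans (_ : _ --> (fun ab => gmul ab.1 ab.2) @ within (composable G) (nbhs (h c0))) _.
    by move=> P /= /h_cvg.
  have /subspace_continuousP := @gmul_continuous G; apply.
  by rewrite /composable /= src_inv; have [_ ->] := gP _ c0U.
rewrite hc0 => /(_ V) /(_ (open_nbhs_nbhs (conj oV Vb0))) VN.
near=> c.
have cU : (@urng G @` U) (urng c) by near: c.
have [Ug rg] := gP _ cU.
exists (g (urng c)), (gmul (h c).1 (h c).2); split => //.
- by near: c; exact: VN.
- by rewrite /= rng_mul ?rng_inv// src_inv.
- by rewrite /= gmulVK.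
Unshelve. all: by end_near. Qed.

Lemma set_mul_bisection U V : compact_open_bisections G U ->
  compact_open_bisections G V -> compact_open_bisections G (set_mul U V).
Proof.
move=> [bU cU] [bV cV]; split; last exact: set_mul_compact.
have [oV _ _] := bV.
apply: open_bisection_intro; first exact: set_mul_open.
- move=> _ _ /set_mem[a [b [Ua Vb ab ->]]] /set_mem[a' [b' [Ua' Vb' ab' ->]]].
  move=> /usrcP; rewrite !src_mul// => /(bisection_srcI bV Vb Vb') bb'.
  rewrite bb'; congr gmul; apply: (bisection_srcI bU) => //.
  by rewrite ab ab' bb'.
- move=> _ _ /set_mem[a [b [Ua Vb ab ->]]] /set_mem[a' [b' [Ua' Vb' ab' ->]]].
  move=> /urngP; rewrite !rng_mul// => /(bisection_rngI bU Ua Ua') aa'.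
  rewrite aa'; congr gmul; apply: (bisection_rngI bV) => //.
  by rewrite -ab -ab' aa'.
Qed.

End AmpleTheory.

Section ConvolutionTheory.
Variables (G : hausdorffAmpleGroupoidType) (S : comNzSemiRingType).
Implicit Types (f g h : G -> S) (U V : set G) (c : G).

Local Notation A := (steinberg_set G S).
Local Notation fiber c := [set ab | composable G ab /\ gmul ab.1 ab.2 = c].

Lemma steinberg_set_subsemimodule : subsemimodule A.
Proof.
split=> [M [[M0 MD MZ] _]|f g Af Ag M MG|k f Af M MG]; first exact: M0.
- have [[_ MD _] _] := MG; by apply: MD; [exact: Af|exact: Ag].
- by have [[_ _ MZ] _] := MG; apply: MZ; exact: Af.
Qed.

Lemma steinberg_set_charfun U : compact_open_bisections G U -> A (charfun S U).
Proof. by move=> cU; apply: sub_gen_smallest; exists U. Qed.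

Lemma steinberg_set_ind (P : set (G -> S)) : subsemimodule P ->
  (forall U, compact_open_bisections G U -> P (charfun S U)) -> A `<=` P.
Proof.
by move=> sP PU; apply: smallest_sub => // _ [U cU <-]; exact: PU.
Qed.

Definition rng_finite f :=
  forall x : G, finite_set [set a | rng a = x /\ f a <> 0].

Lemma steinberg_rng_finite f : A f -> rng_finite f.
Proof.
move: f; apply: steinberg_set_ind => [|U [bU _] x].
  split=> [x|f g Ff Fg x|k f Ff x].
  - by apply: sub_finite_set (finite_set0 _) => a [_].
  - have : finite_set ([set a | rng a = x /\ f a <> 0] `|`
                       [set a | rng a = x /\ g a <> 0]) by rewrite finite_setU.
    apply: sub_finite_set => a [ax fga].
    have [fa|fa] := eqVneq (f a) 0; last by left; split=> //; exact/eqP.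
    right; split=> // ga; apply: fga.
    by rewrite -[LHS]/(f a + g a) fa ga addr0.
  - apply: sub_finite_set (Ff x) => a [ax fa]; split=> // fa0; apply: fa.
    by rewrite fa0 mulr0.
have [[b [Ub bx]]|nb] := pselect (exists b, U b /\ rng b = x).
  apply: sub_finite_set (finite_set1 b) => a [ax]; rewrite /charfun.
  case: ifPn => // /set_mem Ua _; apply: (bisection_rngI bU) => //.
  by rewrite bx.
apply: sub_finite_set (finite_set0 _) => a [ax]; rewrite /charfun.
by case: ifPn => // /set_mem Ua _; apply: nb; exists a.
Qed.

Lemma fiber_finite f c : rng_finite f ->
  finite_set (fiber c `&` [set ab | f ab.1 <> 0]).
Proof.
move=> /(_ (rng c)) /(finite_image (fun a => (a, gmul (ginv a) c))).
apply: sub_finite_set => -[a b] /= [[ab <-] fa].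
by exists a; rewrite ?gmulKV// rng_mul.
Qed.

Lemma convolutionE f g c (D : set (G * G)) : D `<=` fiber c ->
  fiber c `&` [set ab | f ab.1 <> 0] `<=` D ->
  convolution f g c = \sum_(ab \in D) f ab.1 * g ab.2.
Proof.
move=> Dc fD; apply/esym/fsbig_widen => // ab [cab nD] /=.
have [->|/eqP fa] := eqVneq (f ab.1) 0; first by rewrite mul0r.
by case: nD; apply: fD.
Qed.

Lemma convolution_addl f1 f2 g : rng_finite f1 -> rng_finite f2 ->
  convolution (f1 + f2) g = convolution f1 g + convolution f2 g.
Proof.
move=> F1 F2; apply/funext => c.
pose D := (fiber c `&` [set ab | f1 ab.1 <> 0]) `|`
          (fiber c `&` [set ab | f2 ab.1 <> 0]).
have finD : finite_set D by rewrite finite_setU; split; exact: fiber_finite.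
have Dc : D `<=` fiber c by move=> ab [[]|[]].
rewrite -[RHS]/(convolution f1 g c + convolution f2 g c).
rewrite (@convolutionE f1 _ _ D) ?(@convolutionE f2 _ _ D)//; first last.
- by move=> ab; left.
- by move=> ab; right.
rewrite (@convolutionE _ _ _ D)//; last first.
  move=> ab [cab] /= fa.
  have [f1a|/eqP f1a] := eqVneq (f1 ab.1) 0; last by left.
  right; split=> // f2a; apply: fa.
  by rewrite -[LHS]/(f1 ab.1 + f2 ab.1) f1a f2a addr0.
by rewrite -fsbig_split//; apply: eq_fsbigr => ab _; exact: mulrDl.
Qed.

Lemma convolution_addr f g1 g2 : rng_finite f ->
  convolution f (g1 + g2) = convolution f g1 + convolution f g2.
Proof.
move=> F; apply/funext => c.
pose D := fiber c `&` [set ab | f ab.1 <> 0].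
have finD : finite_set D by exact: fiber_finite.
have Dc : D `<=` fiber c by move=> ab [].
rewrite -[RHS]/(convolution f g1 c + convolution f g2 c) !(@convolutionE f _ _ D)//.
by rewrite -fsbig_split//; apply: eq_fsbigr => ab _; exact: mulrDr.
Qed.

Lemma convolution_scalel (k : S) f g : rng_finite f ->
  convolution (fun a => k * f a) g = (fun c => k * convolution f g c).
Proof.
move=> F; apply/funext => c.
pose D := fiber c `&` [set ab | f ab.1 <> 0].
have finD : finite_set D by exact: fiber_finite.
have Dc : D `<=` fiber c by move=> ab [].
rewrite (@convolutionE f _ _ D)// (@convolutionE _ _ _ D)//; last first.
  by move=> ab [cab] /= fa; split=> // f0; apply: fa; rewrite f0 mulr0.
by rewrite fsbig_distrr//; apply: eq_fsbigr => ab _ /=; rewrite mulrA.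
Qed.

Lemma convolution_scaler (k : S) f g : rng_finite f ->
  convolution f (fun a => k * g a) = (fun c => k * convolution f g c).
Proof.
move=> F; apply/funext => c.
pose D := fiber c `&` [set ab | f ab.1 <> 0].
have finD : finite_set D by exact: fiber_finite.
have Dc : D `<=` fiber c by move=> ab [].
rewrite !(@convolutionE f _ _ D)//.
by rewrite fsbig_distrr//; apply: eq_fsbigr => ab _ /=; rewrite mulrCA.
Qed.

Lemma convolution0l g : convolution 0 g = 0.
Proof.
by apply/funext => c; rewrite /convolution fsbig1// => ab _; rewrite mul0r.
Qed.

Lemma convolution0r f : convolution f 0 = 0.
Proof.
by apply/funext => c; rewrite /convolution fsbig1// => ab _; rewrite mulr0.
Qed.

Lemma convolution_charfun U V : open_bisection U -> open_bisection V ->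
  convolution (charfun S U) (charfun S V) = charfun S (set_mul U V).
Proof.
move=> bU bV; apply/funext => c; rewrite [RHS]/charfun.
case: ifPn => [/set_mem[a [b [Ua Vb ab ->]]]|/negP cUV].
  rewrite (@convolutionE _ _ _ [set (a, b)]).
  - by rewrite fsbig_set1 /charfun !ifT ?inE// mulr1.
  - by move=> _ ->.
  - move=> [a' b'] [[ab' e]]; rewrite /charfun /=.
    case: ifPn => // /set_mem Ua' _.
    have aa' : a' = a.
      by apply: (bisection_rngI bU) => //; rewrite -(rng_mul _ _ ab) -e rng_mul.
    by rewrite {}aa' in ab' e *; congr pair; exact: (gmulI ab' ab e).
rewrite /convolution fsbig1// => -[a b] [ab e]; rewrite /charfun /=.
case: ifPn => [/set_mem Ua|_]; last by rewrite mul0r.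
case: ifPn => [/set_mem Vb|_]; last by rewrite mulr0.
by case: cUV; apply/mem_set; exists a, b.
Qed.

Lemma steinberg_convolution f g : A f -> A g -> A (convolution f g).
Proof.
have [A0 AD AZ] := steinberg_set_subsemimodule.
move=> Af Ag.
suff /(_ f Af)[_] :
  A `<=` [set f | A f /\ forall g, A g -> A (convolution f g)] by exact.
move=> {f g Af Ag}; apply: steinberg_set_ind => [|U cU].
  split.
  - by split=> // g _; rewrite convolution0l.
  - move=> f1 f2 [A1 C1] [A2 C2]; split=> [|g Ag]; first exact: AD.
    rewrite convolution_addl; [|exact: steinberg_rng_finite..].
    by apply: AD; [exact: C1|exact: C2].
  - move=> k f [Af C]; split=> [|g Ag]; first exact: AZ.
    by rewrite convolution_scalel; [exact: AZ (C _ Ag)|exact: steinberg_rng_finite].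
have AU := steinberg_set_charfun cU; have FU := steinberg_rng_finite AU.
split=> //; apply: steinberg_set_ind => [|V cV].
  split=> [|g1 g2 C1 C2|k g C] /=.
  - by rewrite convolution0r.
  - by rewrite convolution_addr//; exact: AD.
  - by rewrite convolution_scaler//; exact: AZ.
rewrite /= convolution_charfun; [|by case: cU|by case: cV].
exact: steinberg_set_charfun (set_mul_bisection cU cV).
Qed.

Lemma convolutionA f g h : A f -> A g -> A h ->
  convolution f (convolution g h) = convolution (convolution f g) h.
Proof.
have [A0 AD AZ] := steinberg_set_subsemimodule.
have RF := steinberg_rng_finite; have AC := steinberg_convolution.
pose P f g h :=
  convolution f (convolution g h) = convolution (convolution f g) h.
have Ph f1 g1 : A f1 -> A g1 ->
    (forall U, compact_open_bisections G U -> P f1 g1 (charfun S U)) ->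
    forall h1, A h1 -> P f1 g1 h1.
  move=> /[dup] Af /RF Ff /[dup] Ag /RF Fg; have Ffg := RF _ (AC _ _ Af Ag).
  apply: steinberg_set_ind; rewrite /P; split=> [|h1 h2 C1 C2|k h' C] /=.
  - by rewrite !convolution0r.
  - by rewrite !convolution_addr// C1 C2.
  - by rewrite !convolution_scaler// C.
have Pg f1 : A f1 -> (forall U, compact_open_bisections G U ->
      forall h1, A h1 -> P f1 (charfun S U) h1) ->
    forall g1, A g1 -> forall h1, A h1 -> P f1 g1 h1.
  move=> /[dup] Af /RF Ff PU g' Ag' h' Ah'.
  suff /(_ g' Ag')[] : A `<=` [set g2 | A g2 /\ P f1 g2 h'] by [].
  move=> {g' Ag'}; apply: steinberg_set_ind; last first.
    by move=> U cU; split; [exact: steinberg_set_charfun|exact: PU].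
  rewrite /P; split=> [|g1 g2 [A1 C1] [A2 C2]|k g' [Ag' C]] /=; split=> //.
  - by rewrite !(convolution0r, convolution0l).
  - exact: AD.
  - rewrite (convolution_addl _ (RF _ A1) (RF _ A2)) !convolution_addr//.
    by rewrite convolution_addl ?C1 ?C2//; apply: RF; apply: AC.
  - exact: AZ.
  - rewrite (convolution_scalel _ _ (RF _ Ag')) !convolution_scaler//.
    by rewrite convolution_scalel ?C//; apply: RF; apply: AC.
move=> Af Ag Ah; suff /(_ f Af)[] : A `<=` [set f2 | A f2 /\ P f2 g h] by [].
move=> {f Af}; apply: steinberg_set_ind.
  rewrite /P; split=> [|f1 f2 [A1 C1] [A2 C2]|k f [Af C]] /=; split=> //.
  - by rewrite !convolution0l.
  - exact: AD.
  - rewrite !(convolution_addl _ (RF _ A1) (RF _ A2)) C1 C2.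
    by rewrite convolution_addl//; apply: RF; apply: AC.
  - exact: AZ.
  - rewrite !(convolution_scalel _ _ (RF _ Af)) C.
    by rewrite convolution_scalel//; apply: RF; apply: AC.
move=> U cU; have AU := steinberg_set_charfun cU; split=> //.
apply: Pg => // V cV; have AV := steinberg_set_charfun cV.
apply: Ph => // W cW; rewrite /P.
have [[bU _] [bV _] [bW _]] := And3 cU cV cW.
have [bUV _] := set_mul_bisection cU cV.
have [bVW _] := set_mul_bisection cV cW.
by rewrite !convolution_charfun// set_mulA.
Qed.

Lemma steinberg_continuous f : A f ->
  continuous (f : G -> discrete_topology S).
Proof.
have locP f' : continuous (f' : G -> discrete_topology S) <->
    forall x, \forall y \near x, f' y = f' x.
  split=> [cf x|cf x]; first exact: (cf x _ (discrete_set1 _)).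
  by apply/discrete_cvg; exact: cf.
move: f; apply: steinberg_set_ind => [|U [[oU _ _] cU]].
  split=> [|f g /locP cf /locP cg|k f /locP cf]; apply/locP => x.
  - exact: nearW.
  - near=> y; congr (_ + _); first by near: y; exact: cf.
    by near: y; exact: cg.
  - by near=> y; congr (_ * _); near: y; exact: cf.
apply/locP => x; rewrite /charfun.
case: ifPn => [/set_mem Ux|/negP nUx].
  by near=> y; rewrite ifT// inE; near: y; exact: open_nbhs_nbhs.
near=> y; rewrite ifF//; apply/negbTE/negP; rewrite inE.
near: y; apply: open_nbhs_nbhs; split; last by move=> Ux; apply: nUx; rewrite inE.
by rewrite openC; exact: compact_closed (@groupoid_hausdorff G) cU.
Unshelve. all: by end_near. Qed.

End ConvolutionTheory.

Record steinberg (G : hausdorffAmpleGroupoidType) (S : comNzSemiRingType) :=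
  Steinberg { steinberg_fun :> G -> S; _ : steinberg_fun \in steinberg_set G S }.

Section SteinbergHemiring.
Variables (G : hausdorffAmpleGroupoidType) (S : comNzSemiRingType).
Implicit Types f g h : steinberg G S.

HB.instance Definition _ := [isSub for @steinberg_fun G S].
HB.instance Definition _ := [Choice of steinberg G S by <:].

Fact steinberg_nmod_closed :
  GRing.nmod_closed [pred f : G -> S | f \in steinberg_set G S].
Proof.
have [A0 AD _] := steinberg_set_subsemimodule G S.
by split=> [|f g]; rewrite !inE; [exact: A0|exact: AD].
Qed.
HB.instance Definition _ :=
  GRing.SubChoice_isSubNmodule.Build (G -> S) _ (steinberg G S)
    steinberg_nmod_closed.

Lemma steinbergP f : steinberg_set G S f.
Proof. by apply/set_mem; case: f. Qed.

Definition steinberg_mul f g : steinberg G S :=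
  Steinberg (mem_set (steinberg_convolution (steinbergP f) (steinbergP g))).

Fact steinberg_mulA : associative steinberg_mul.
Proof.
by move=> f g h; apply/val_inj/convolutionA; exact: steinbergP.
Qed.
HB.instance Definition _ := hasMul.Build (steinberg G S) steinberg_mul.
HB.instance Definition _ :=
  Magma_isSemigroup.Build (steinberg G S) steinberg_mulA.

Fact steinberg_mulDl f g h : ((f + g)%R * h)%g = (f * h)%g + (g * h)%g.
Proof.
have Ff := steinberg_rng_finite (steinbergP f).
have Fg := steinberg_rng_finite (steinbergP g).
by apply/val_inj; exact: (convolution_addl _ Ff Fg).
Qed.

Fact steinberg_mulDr f g h : (f * (g + h)%R)%g = (f * g)%g + (f * h)%g.
Proof.
have Ff := steinberg_rng_finite (steinbergP f).
by apply/val_inj; exact: (convolution_addr _ _ Ff).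
Qed.

Fact steinberg_mul0l f : ((0%R : steinberg G S) * f)%g = 0.
Proof. by apply/val_inj; exact: convolution0l. Qed.

Fact steinberg_mul0r f : (f * (0%R : steinberg G S))%g = 0.
Proof. by apply/val_inj; exact: convolution0r. Qed.

HB.instance Definition _ :=
  Nmodule_Semigroup_isHemiring.Build (steinberg G S) steinberg_mulDl
    steinberg_mulDr steinberg_mul0l steinberg_mul0r.

End SteinbergHemiring.

(* Main.v *)
From HB Require Import structures.
Require Import Defs.
From mathcomp Require Import all_boot all_order all_algebra.
From mathcomp Require Import all_classical.
From mathcomp Require Import topology.

Set Implicit Arguments.
Unset Strict Implicit.
Unset Printing Implicit Defensive.

Import GRing.Theory.
Local Open Scope classical_set_scope.
Local Open Scope ring_scope.

(** Sufficiency.  Let a congruence relate [f] and [g] with [f <> g].  Over a field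
    one subtracts [g], and over the Boolean semifield the values are [0] and [1];
    in both cases some related pair takes an invertible value and the value [0]
    at a common arrow.  Translation by a bisection moves this arrow to a unit.
    Effectiveness yields an open set [U] of units, inside any given one, such
    that compression by [1_U] kills a given function off the units
    ([compression_units]): an arrow with distinct ends can be cut off by
    separating them, and effectiveness says that such arrows are dense off the
    units.  After compression the pair becomes an invertible multiple of [1_U]
    and [0], so [1_U] is related to [0] ([exists_null]).  The sources of all
    bisections that are null in this sense form an open invariant set, which is
    everything by minimality ([minimal_null]); a compactness argument and
    disjoint unions show that all compact open bisections are null
    ([null_all]), so the congruence is universal ([null_universal]).

    Necessity.  Each condition is read off from a suitable congruence.
    Comparing values modulo a congruence of [S] shows that [S] has no proper
    congruence, and such a commutative semiring is a field or the Boolean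
    semifield ([simple_classification]): its Bourne congruences show that either
    all its elements have opposites, and then nonzero elements have inverses, or
    no nonzero element has one, and then [x |-> (x != 0)] is an isomorphism to
    the Boolean semifield.  Comparing values at the arrows with source outside an
    open invariant set gives minimality ([simple_minimal]).  Finally the algebra
    acts on the functions on the unit space, and a bisection [B] contained in the
    isotropy acts like its set of sources; as the action is nonzero, it is
    faithful, so [B] consists of units ([simple_effective]). *)

(** * Compactness by absorption *)

(** The finite subcover is replaced by its consequence: a family of sets that is
    closed under binary unions absorbs a compact set as soon as it does so
    locally. *)
Lemma compact_directed (T : topologicalType) (K : set T) (Q : set (set T)) :
  compact K -> Q !=set0 -> (forall U V, Q U -> Q V -> Q (U `|` V)) ->
  (forall x, K x -> exists U, [/\ Q U, open U & U x]) ->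
  exists2 U, Q U & K `<=` U.
Proof.
move=> /compact_near_coveringP cK Q0 QU Qloc.
pose F : set_system (set T) := filter_from Q (fun U => [set W | U `<=` W]).
have FF : Filter F.
  apply: filter_from_filter => [//|U V qU qV].
  exists (U `|` V); first exact: QU.
  by move=> W /= UVW; split=> x Ux; apply: UVW; [left|right].
have [x Kx|U qU /(_ U) UK] := cK _ F (fun W x => W x) FF _.
  have [U [qU oU Ux]] := Qloc x Kx.
  exists (U, [set W | U `<=` W]).
    by split; [exact: open_nbhs_nbhs|exists U].
  by move=> [y W] /= [Uy UW]; exact: UW.
by exists U => //; exact: UK.
Qed.

(** * Compact open bisections *)

Section Bisections.
Variable G : hausdorffAmpleGroupoidType.
Implicit Types (U V W B : set G) (a b c : G).

Lemma src_unit a : units G a -> src a = a.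
Proof. by move=> [b _ <-]; rewrite src_src. Qed.

Lemma rng_unit a : units G a -> rng a = a.
Proof. by move=> [b _ <-]; rewrite rng_src. Qed.

Lemma src_in_units a : units G (src a).
Proof. by exists a. Qed.

Lemma src_continuous : continuous (@src G).
Proof.
move=> a; apply: (@continuous_comp _ _ _ (@usrc G) (@set_val _ (units G))).
  exact: usrc_continuous.
exact: initial_continuous.
Qed.

Lemma rng_continuous : continuous (@rng G).
Proof.
move=> a; apply: (@continuous_comp _ _ _ (@urng G) (@set_val _ (units G))).
  exact: urng_continuous.
exact: initial_continuous.
Qed.

Lemma open_src_preimage W : open W -> open (@src G @^-1` W).
Proof. by have /continuousP := src_continuous; apply. Qed.

Lemma open_rng_preimage W : open W -> open (@rng G @^-1` W).
Proof. by have /continuousP := rng_continuous; apply. Qed.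

(** If the source map is injective on a neighbourhood [U] of the unit [x], then
    every [a] in [U] with [src a] in [U] has the same source as [src a], so it
    equals [src a] and is a unit. *)
Lemma units_open : open (units G).
Proof.
rewrite openE => x ux.
have [U [[oU Ux] /homeo_inj I]] := @usrc_local_homeo G x.
rewrite /interior nbhsE /=; exists (U `&` @src G @^-1` U).
  split; first by apply: openI => //; exact: open_src_preimage.
  by split=> //=; rewrite (src_unit ux).
move=> a [Ua Usa]; exists (src a) => //; rewrite src_src.
by apply: I; rewrite ?inE//; apply/usrcP; rewrite src_src.
Qed.

Lemma units_closed : closed (units G).
Proof.
rewrite -[units G]setCK closedC openE => a na.
have sa : a != src a by apply: contra_not_neq na => ->; exact: src_in_units.
have := @groupoid_hausdorff G; rewrite open_hausdorff => /(_ _ _ sa).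
move=> [[A B] /= [/set_mem Aa /set_mem Bb] [oA oB /eqP AB0]].
rewrite /interior nbhsE /=; exists (A `&` @src G @^-1` B).
  split; first by apply: openI => //; exact: open_src_preimage.
  by [].
move=> c [Ac Bc] uc; have : (A `&` B) c.
  by split=> //; move: Bc => /=; rewrite (src_unit uc).
by rewrite AB0.
Qed.

Lemma src_image_open W : open W -> open (@src G @` W).
Proof.
move=> oW.
have -> : @src G @` W = units G `&` @usrc G @^-1` (@usrc G @` W).
  apply/seteqP; split=> x.
    move=> [a Wa <-]; split; first exact: src_in_units.
    by exists a => //; apply/usrcP; rewrite src_src.
  by move=> [ux [a Wa /usrcP e]]; exists a => //; rewrite e src_unit.
apply: openI; first exact: units_open.
by have /continuousP := @usrc_continuous G; apply; exact: usrc_open.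
Qed.

Lemma basis_bisection W a : open W -> W a ->
  exists B, [/\ compact_open_bisections G B, B a & B `<=` W].
Proof.
move=> oW Wa; have [_ [_ /(_ a W)]] := @groupoid_ample G.
by move=> /(_ (open_nbhs_nbhs (conj oW Wa)))[B [cB Ba] BW]; exists B.
Qed.

Lemma exists_bisection a : exists2 B, compact_open_bisections G B & B a.
Proof.
by have [B [cB Ba _]] := basis_bisection openT (I : setT a); exists B.
Qed.

Lemma sub_open_bisection U V : open_bisection U -> open V -> V `<=` U ->
  open_bisection V.
Proof.
move=> bU oV VU; have [_ /homeo_inj Is /homeo_inj Ir] := bU.
by apply: open_bisection_intro => // a b /set_mem Va /set_mem Vb;
  [apply: Is|apply: Ir]; rewrite inE; exact: VU.
Qed.

Lemma open_units_bisection V : open V -> V `<=` units G -> open_bisection V.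
Proof.
by move=> oV Vu; apply: open_bisection_intro => // a b /set_mem/Vu ua
  /set_mem/Vu ub; [move=> /usrcP|move=> /urngP];
  rewrite ?(src_unit ua) ?(src_unit ub) ?(rng_unit ua) ?(rng_unit ub).
Qed.

Lemma bisection_closed B : compact_open_bisections G B -> closed B.
Proof. by move=> [_ cB]; exact: compact_closed (@groupoid_hausdorff G) cB. Qed.

Lemma set0_bisection : compact_open_bisections G set0.
Proof.
split; last exact: compact0.
by apply: open_units_bisection => //; exact: open0.
Qed.

Lemma setI_bisection U V : compact_open_bisections G U ->
  compact_open_bisections G V -> compact_open_bisections G (U `&` V).
Proof.
move=> [bU cU] cobV; have [[oV _ _] _] := cobV; have [oU _ _] := bU; split.
  by apply: (sub_open_bisection bU); [exact: openI|exact: subIsetl].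
by apply: compact_closedI => //; exact: bisection_closed.
Qed.

Lemma setD_bisection U V : compact_open_bisections G U ->
  compact_open_bisections G V -> compact_open_bisections G (U `\` V).
Proof.
move=> [bU cU] cobV; have [[oV _ _] _] := cobV; have [oU _ _] := bU; split.
  apply: (sub_open_bisection bU); last exact: subDsetl.
  by apply: openI => //; rewrite openC; exact: bisection_closed.
by apply: compact_closedI => //; exact: open_closedC.
Qed.

Lemma setU_sub_bisection B U V : compact_open_bisections G B ->
  compact_open_bisections G U -> compact_open_bisections G V ->
  U `|` V `<=` B -> compact_open_bisections G (U `|` V).
Proof.
move=> [bB _] [[oU _ _] cU] [[oV _ _] cV] UVB; split; last exact: compactU.
by apply: (sub_open_bisection bB) => //; exact: openU.
Qed.

Lemma src_image_bisection U : compact_open_bisections G U ->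
  compact_open_bisections G (@src G @` U).
Proof.
move=> [[oU _ _] cU]; split.
  apply: open_units_bisection; first exact: src_image_open.
  by move=> _ [a _ <-]; exact: src_in_units.
apply: continuous_compact cU.
exact/continuous_subspaceT/src_continuous.
Qed.

(** Translating the source of [a] to that of [b] requires [b a^-1], which is
    contained in some compact open bisection. *)
Lemma bisection_translate a b : src a = src b ->
  exists B, compact_open_bisections G B /\
            exists2 c, B c & src c = rng a /\ gmul c a = b.
Proof.
move=> ab; have [B cB Bc] := exists_bisection (gmul b (ginv a)).
have bia : src b = rng (ginv a) by rewrite rng_inv.
exists B; split=> //; exists (gmul b (ginv a)) => //.
by split; [rewrite src_mul// src_inv|
           rewrite -gmulA ?src_inv// gmulVg ab gmul_src].
Qed.

End Bisections.
(** * Convolution with the characteristic function of a bisection *)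

Section Translation.
Variables (G : hausdorffAmpleGroupoidType) (S : comNzSemiRingType).
Implicit Types (U V W B : set G) (a b c : G) (f g h phi : G -> S).

Local Notation A := (steinberg_set G S).
Local Notation chi := (charfun S).

Lemma charfun1 U a : U a -> chi U a = 1.
Proof. by move=> Ua; rewrite /charfun ifT// inE. Qed.

Lemma charfun0 U a : ~ U a -> chi U a = 0.
Proof. by move=> nUa; rewrite /charfun ifF//; apply/negP; rewrite inE. Qed.

Lemma convolution_point f g a b c : src a = rng b -> gmul a b = c ->
  (forall a' b', src a' = rng b' -> gmul a' b' = c -> a' <> a ->
     f a' * g b' = 0) ->
  convolution f g c = f a * g b.
Proof.
move=> ab abc fg0; rewrite -(fsbig_set1 +%R (a, b) (fun ab => f ab.1 * g ab.2)).
apply/esym/fsbig_widen => [_ -> //|[a' b'] /= [[ab' abc'] ne]].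
apply: fg0 => // aa'; apply: ne; rewrite {}aa' in ab' abc' *.
by congr pair; apply: (gmulI ab' ab); rewrite abc' abc.
Qed.

Lemma convolution_nil f g c :
  (forall a b, src a = rng b -> gmul a b = c -> f a * g b = 0) ->
  convolution f g c = 0.
Proof.
by move=> fg0; rewrite /convolution fsbig1// => -[a b] [ab /= abc]; exact: fg0.
Qed.

Lemma charfun_convolution U h a c : open_bisection U -> U a -> rng a = rng c ->
  convolution (chi U) h c = h (gmul (ginv a) c).
Proof.
move=> bU Ua ac; rewrite (@convolution_point _ _ a (gmul (ginv a) c)).
- by rewrite charfun1// mul1r.
- by rewrite rng_mul ?rng_inv// src_inv.
- by rewrite gmulVK.
- move=> a' b' ab' abc' ne; rewrite charfun0 ?mul0r// => Ua'; apply: ne.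
  by apply: (bisection_rngI bU) => //; rewrite ac -abc' rng_mul.
Qed.

Lemma charfun_convolution0 U h c : (forall a, U a -> rng a <> rng c) ->
  convolution (chi U) h c = 0.
Proof.
move=> Uc; apply: convolution_nil => a b ab abc.
by rewrite charfun0 ?mul0r// => /Uc; apply; rewrite -abc rng_mul.
Qed.

Lemma convolution_charfun_r U h b c : open_bisection U -> U b ->
  src b = src c -> convolution h (chi U) c = h (gmul c (ginv b)).
Proof.
move=> bU Ub bc; rewrite (@convolution_point _ _ (gmul c (ginv b)) b).
- by rewrite charfun1// mulr1.
- by rewrite src_mul ?src_inv ?rng_inv.
- by rewrite -gmulA ?src_inv ?rng_inv// gmulVg bc gmul_src.
- move=> a' b' ab' abc' ne; rewrite charfun0 ?mulr0// => Ub'; apply: ne.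
  have <- : b' = b.
    by apply: (bisection_srcI bU) => //; rewrite bc -abc' src_mul.
  by rewrite -abc' -gmulA ?rng_inv// gmulgV -ab' gmul_src.
Qed.

Lemma convolution_charfun_r0 U h c : (forall b, U b -> src b <> src c) ->
  convolution h (chi U) c = 0.
Proof.
move=> Uc; apply: convolution_nil => a b ab abc.
by rewrite (charfun0 (a := b)) ?mulr0// => /Uc; apply; rewrite -abc src_mul.
Qed.

Lemma charfun_units_convolution V h c : open V -> V `<=` units G ->
  convolution (chi V) h c = if rng c \in V then h c else 0.
Proof.
move=> oV Vu; case: ifPn => [/set_mem Vc|nVc].
  rewrite (charfun_convolution _ (open_units_bisection oV Vu) Vc) ?rng_rng//.
  by have := gmulKV (src_rng c); rewrite gmul_rng => ->.
apply: charfun_convolution0 => a Va; rewrite (rng_unit (Vu _ Va)) => ac.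
by move/negP: nVc; apply; rewrite inE -ac.
Qed.

Lemma convolution_charfun_units V h c : open V -> V `<=` units G ->
  convolution h (chi V) c = if src c \in V then h c else 0.
Proof.
move=> oV Vu; case: ifPn => [/set_mem Vc|nVc].
  rewrite (convolution_charfun_r _ (open_units_bisection oV Vu) Vc) ?src_src//.
  rewrite -{1}[c]gmul_src -gmulA ?rng_inv ?rng_src ?src_src//.
  by rewrite gmulgV rng_src gmul_src.
apply: convolution_charfun_r0 => b Vb; rewrite (src_unit (Vu _ Vb)) => bc.
by move/negP: nVc; apply; rewrite inE -bc.
Qed.

(** Compressing [f] by an open set [V] of units keeps exactly the arrows of [f]
    that start and end in [V]. *)
Lemma compression V f c : open V -> V `<=` units G ->
  convolution (convolution (chi V) f) (chi V) c =
  if (src c \in V) && (rng c \in V) then f c else 0.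
Proof.
move=> oV Vu; rewrite convolution_charfun_units// charfun_units_convolution//.
by case: (src c \in V).
Qed.

(** A sub-bisection is cut out of a bisection by its set of sources. *)
Lemma charfun_sub_bisection U V : compact_open_bisections G U ->
  compact_open_bisections G V -> V `<=` U ->
  convolution (chi U) (chi (@src G @` V)) = chi V.
Proof.
move=> [bU _] [[oV _ _] _] VU; apply/funext => c.
rewrite convolution_charfun_units//; first last.
- by move=> _ [a _ <-]; exact: src_in_units.
- exact: src_image_open.
case: ifPn => [/set_mem[a Va ac]|nVc].
  have [Uc|nUc] := pselect (U c); last first.
    by rewrite !charfun0// => /VU.
  have ca : a = c by apply: (bisection_srcI bU) => //; exact: VU.
  by rewrite !charfun1 -?ca//; exact: VU.
rewrite charfun0// => Vc; move/negP: nVc; apply; rewrite inE; by exists c.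
Qed.

Lemma charfunU_disjoint U V : U `&` V = set0 -> chi (U `|` V) = chi U + chi V.
Proof.
move=> UV0; apply/funext => x; rewrite -[RHS]/(chi U x + chi V x).
have [Ux|nUx] := pselect (U x).
  rewrite (charfun1 (_ : (U `|` V) x)); last by left.
  rewrite (charfun1 Ux) charfun0 ?addr0// => Vx.
  by have : (U `&` V) x by []; rewrite UV0.
rewrite (charfun0 nUx) add0r; have [Vx|nVx] := pselect (V x).
  by rewrite !charfun1//; right.
by rewrite !charfun0// => -[].
Qed.

End Translation.

(** * Isolating the unit part of a function by compression *)

Section Compression.
Variables (G : hausdorffAmpleGroupoidType) (S : comNzSemiRingType).
Hypothesis effG : effective G.
Implicit Types (U V W B : set G) (a b c : G) (f : G -> S).

Lemma effective_anisotropic W : open W -> W !=set0 -> W `<=` ~` units G ->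
  exists2 a, W a & src a <> rng a.
Proof.
move=> oW [x Wx] Wu; apply: contrapT => Wiso.
suff : interior (iso G `\` units G) x by rewrite effG.
rewrite /interior nbhsE /=; exists W => // a Wa; split; last exact: Wu.
by apply: contrapT => ne; apply: Wiso; exists a.
Qed.

(** Any bisection [B] disappears outside the units after a compression by a small
    enough set of units.  If some arrow of [B] outside the units has both ends
    in [V], then so does one with distinct ends, which can be separated; the
    sources of the nearby arrows of [B] form the required set, because [B] moves
    each of them to the other side of the separation. *)
Lemma compression_bisection B V : open_bisection B ->
  open V -> V !=set0 -> V `<=` units G ->
  exists V', [/\ open V', V' !=set0, V' `<=` V &
    forall c, B c -> V' (src c) -> V' (rng c) -> units G c].
Proof.
move=> bB oV V0 Vu; have [oB _ _] := bB.
pose W := (B `&` ~` units G) `&` (@src G @^-1` V `&` @rng G @^-1` V).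
have oW : open W.
  apply: openI; first by apply: openI => //; rewrite openC; exact: units_closed.
  by apply: openI; [exact: open_src_preimage|exact: open_rng_preimage].
have [W0|/set0P W0] := eqVneq W set0.
  exists V; split=> // c Bc sc rc; apply: contrapT => nc.
  by have : W c by []; rewrite W0.
have [a Wa /eqP sra] : exists2 a, W a & src a <> rng a.
  by apply: effective_anisotropic => // c [[]].
have := @groupoid_hausdorff G; rewrite open_hausdorff => /(_ _ _ sra).
move=> [[O1 O2] /= [/set_mem O1a /set_mem O2a] [oO1 oO2 /eqP O0]].
pose W' := W `&` (@src G @^-1` O1 `&` @rng G @^-1` O2).
exists (@src G @` W'); split.
- apply: src_image_open; apply: openI => //.
  by apply: openI; [exact: open_src_preimage|exact: open_rng_preimage].
- by exists (src a); exists a.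
- by move=> _ [b [[_ [Vb _]] _] <-].
- move=> c Bc [b [[[Bb _] _] [O1b O2b]] bc] [d [_ [O1d _]] dc].
  have eqbc : b = c by apply: (bisection_srcI bB).
  have : (O1 `&` O2) (rng c).
    by split; [rewrite -dc; exact: O1d|rewrite -eqbc; exact: O2b].
  by rewrite O0.
Qed.

Lemma compression_units f : steinberg_set G S f ->
  forall V, open V -> V !=set0 -> V `<=` units G ->
  exists V', [/\ open V', V' !=set0, V' `<=` V &
    forall c, V' (src c) -> V' (rng c) -> ~ units G c -> f c = 0].
Proof.
move: f; apply: steinberg_set_ind => [|B [bB _] V oV V0 Vu].
  split=> [V oV V0 _|f g Pf Pg V oV V0 Vu|k f Pf V oV V0 Vu].
  - by exists V; split.
  - have [V1 [oV1 V10 V1V f0]] := Pf _ oV V0 Vu.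
    have [V2 [oV2 V20 V21 g0]] := Pg _ oV1 V10 (subset_trans V1V Vu).
    exists V2; split=> // [|c sc rc nc]; first exact: subset_trans V21 V1V.
    by rewrite -[LHS]/(f c + g c) g0// f0 ?addr0//; exact: V21.
  - have [V1 [oV1 V10 V1V f0]] := Pf _ oV V0 Vu.
    by exists V1; split=> // c sc rc nc; rewrite f0// mulr0.
have [V' [oV' V'0 V'V BV']] := compression_bisection bB oV V0 Vu.
exists V'; split=> // c sc rc nc; apply: charfun0 => Bc; apply: nc.
exact: BV'.
Qed.

End Compression.

(** * Congruences of a Steinberg algebra *)

Section SteinbergCongruence.
Variables (G : hausdorffAmpleGroupoidType) (S : comNzSemiRingType).
Variable rho : steinberg G S -> steinberg G S -> Prop.
Hypothesis rhoP : congruence rho.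
Implicit Types (U V W B : set G) (a b c : G) (f g h : G -> S) (k : S).

Local Notation A := (steinberg_set G S).
Local Notation chi := (charfun S).

(** The congruence read on bare functions, which spares a membership proof in
    every intermediate expression. *)
Definition congruent f g :=
  exists F H : steinberg G S,
    [/\ F = f :> (G -> S), H = g :> (G -> S) & rho F H].

Local Notation "f ~ g" := (congruent f g) (at level 70).

Lemma congruentE (F H : steinberg G S) : (F : G -> S) ~ H -> rho F H.
Proof. by move=> [F' [H' [/val_inj -> /val_inj ->]]]. Qed.

Lemma congruent_refl f : A f -> f ~ f.
Proof.
move=> /mem_set Af; exists (Steinberg Af), (Steinberg Af).
by split=> //; exact: congruence_refl.
Qed.

Lemma congruent_sym f g : f ~ g -> g ~ f.
Proof.
by move=> [F [H [<- <- FH]]]; exists H, F; split=> //; exact: congruence_sym.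
Qed.

Lemma congruentD f g f' g' : f ~ g -> f' ~ g' -> f + f' ~ g + g'.
Proof.
move=> [F [H [<- <- FH]]] [F' [H' [<- <- FH']]].
exists (F + F'), (H + H'); split=> //.
apply: (congruence_trans rhoP (b := F + H')); first exact: congruence_add.
by rewrite ![_ + H']addrC; exact: congruence_add.
Qed.

Lemma congruentMl h f g : A h -> f ~ g -> convolution h f ~ convolution h g.
Proof.
move=> /mem_set Ah [F [H [<- <- FH]]].
exists (Steinberg Ah * F)%g, (Steinberg Ah * H)%g.
by split=> //; exact: congruence_mull.
Qed.

Lemma congruentMr h f g : A h -> f ~ g -> convolution f h ~ convolution g h.
Proof.
move=> /mem_set Ah [F [H [<- <- FH]]].
exists (F * Steinberg Ah)%g, (H * Steinberg Ah)%g.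
by split=> //; exact: congruence_mulr.
Qed.

Lemma congruent_universal : (forall f, A f -> f ~ 0) -> forall F H, rho F H.
Proof.
have F0 F : (forall f, A f -> f ~ 0) -> rho F 0.
  by move=> A0; apply: congruentE; exact: (A0 _ (steinbergP F)).
move=> A0 F H; apply: (congruence_trans rhoP (F0 F A0)).
exact/(congruence_sym rhoP)/F0.
Qed.

Lemma steinberg_scale k f : A f -> A (fun x => k * f x).
Proof. by have [_ _ AZ] := @steinberg_set_subsemimodule G S; exact: AZ. Qed.

(** The zero class is an ideal; a compact open bisection is null when its
    characteristic function lies in it. *)
Definition null U := compact_open_bisections G U /\ chi U ~ 0.

Lemma null_sub U V : null U -> compact_open_bisections G V -> V `<=` U ->
  null V.
Proof.
move=> [cU U0] cV VU; split=> //; rewrite -(charfun_sub_bisection _ cU cV VU).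
rewrite -[X in _ ~ X](@convolution0l _ _ (chi (@src G @` V))).
apply: congruentMr => //; apply: steinberg_set_charfun.
exact: src_image_bisection.
Qed.

Lemma null_mull U V : compact_open_bisections G V -> null U ->
  null (set_mul V U).
Proof.
move=> cV [cU U0]; split; first exact: set_mul_bisection.
rewrite -convolution_charfun; [|by case: cV|by case: cU].
rewrite -[X in _ ~ X](convolution0r (chi V)).
by apply: congruentMl => //; exact: steinberg_set_charfun.
Qed.

Lemma null_mulr U V : compact_open_bisections G V -> null U ->
  null (set_mul U V).
Proof.
move=> cV [cU U0]; split; first exact: set_mul_bisection.
rewrite -convolution_charfun; [|by case: cU|by case: cV].
rewrite -[X in _ ~ X](convolution0l (chi V)).
by apply: congruentMr => //; exact: steinberg_set_charfun.
Qed.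

(** The union is the disjoint union of [U] and [V \ U]. *)
Lemma null_setU U V : compact_open_bisections G (U `|` V) -> null U -> null V ->
  null (U `|` V).
Proof.
move=> cUV nU nV; split=> //; have [[cU U0] [cV _]] := (nU, nV).
have [_ VU0] := null_sub nV (setD_bisection cV cU) (@subDsetl _ _ _).
have -> : U `|` V = U `|` (V `\` U).
  apply/seteqP; split=> x; last by case=> [|[]]; [left|right].
  have [Ux _|nUx [//|Vx]] := pselect (U x); first by left.
  by right.
rewrite charfunU_disjoint; last by apply/seteqP; split=> x // [Ux []].
by rewrite -[X in _ ~ X]addr0; exact: congruentD.
Qed.

(** Translation puts every arrow into a null bisection; compactness then makes
    all compact open bisections null. *)
Lemma null_all : (forall x, units G x -> exists2 U, null U & (@src G @` U) x) ->
  forall V, compact_open_bisections G V -> null V.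
Proof.
move=> nullG V cV; pose Q U := null U /\ U `<=` V.
have [||x Vx|U [nU UV] VU] := @compact_directed _ V Q (proj2 cV).
- exists set0; split=> //; split; first exact: set0_bisection.
  rewrite (_ : chi set0 = 0); last by apply/funext => x; rewrite charfun0.
  by apply: congruent_refl; case: (@steinberg_set_subsemimodule G S).
- move=> U W [nU UV] [nW WV]; have UWV : U `|` W `<=` V by move=> x [/UV|/WV].
  split=> //; apply: null_setU => //.
  by apply: (setU_sub_bisection cV) => //; [case: nU|case: nW].
- have [U nU [u Uu ux]] := nullG _ (src_in_units x).
  have [B [cB [b Bb [bu bux]]]] := bisection_translate ux.
  have nBU := null_mull cB nU; have [cBU _] := nBU.
  have cVBU := setI_bisection cV cBU; have [[oVBU _ _] _] := cVBU.
  exists (V `&` set_mul B U); split=> //; last first.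
    by split=> //; exists b, u; split=> //; rewrite bux.
  split; last exact: subIsetl.
  by apply: (null_sub nBU) => //; exact: subIsetr.
- by have -> : V = U by apply/seteqP.
Qed.

Lemma null_universal : (forall V, compact_open_bisections G V -> null V) ->
  forall F H, rho F H.
Proof.
move=> nullG; apply: congruent_universal => f Af.
suff : forall k, (fun x => k * f x) ~ 0.
  move=> /(_ 1); rewrite (_ : (fun x => 1 * f x) = f)//.
  by apply/funext => x; rewrite mul1r.
move: f Af; apply: steinberg_set_ind => [|V cV k].
  split=> [k|f g Pf Pg k|l f Pf k].
  - rewrite (_ : (fun _ => _) = 0); last by apply/funext => x; exact: mulr0.
    by apply: congruent_refl; case: (@steinberg_set_subsemimodule G S).
  - rewrite (_ : (fun _ => _) = (fun x => k * f x) + (fun x => k * g x)).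
      by rewrite -[X in _ ~ X]addr0; exact: congruentD.
    by apply/funext => x; exact: mulrDr.
  - rewrite (_ : (fun _ => _) = (fun x => k * l * f x))//.
    by apply/funext => x; rewrite mulrA.
have csV := src_image_bisection cV.
rewrite -(charfun_sub_bisection S cV cV)//.
rewrite -convolution_scaler;
  last by apply: steinberg_rng_finite; exact: steinberg_set_charfun.
rewrite -[X in _ ~ X](convolution0l (fun a => k * chi (@src G @` V) a)).
apply: congruentMr; last by have [] := nullG _ cV.
by apply: steinberg_scale; exact: steinberg_set_charfun.
Qed.

(** The sources of the arrows of null bisections form an open set, invariant
    because the null bisections absorb products. *)
Lemma minimal_null : minimal G -> (exists2 U, null U & U !=set0) ->
  forall V, compact_open_bisections G V -> null V.
Proof.
move=> minG [U nU [u Uu]].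
pose D : set (units G) := [set x | exists2 W, null W & (@usrc G @` W) x].
have [||D0|DT] := minG D.
- rewrite openE => _ [W nW [w Ww <-]]; have [[[oW _ _] _] _] := nW.
  rewrite /interior nbhsE /=; exists (@usrc G @` W); last first.
    by move=> x Wx; exists W.
  by split; [exact: usrc_open|exists w].
- move=> a [W nW [w Ww /usrcP wa]]; have [B cB Ba] := exists_bisection (ginv a).
  exists (set_mul W B); first exact: null_mulr.
  have wia : src w = rng (ginv a) by rewrite rng_inv.
  exists (gmul w (ginv a)); first by exists w, (ginv a).
  by apply: val_inj; rewrite /= src_mul// src_inv.
- have : D (usrc u) by exists U => //; exists u.
  by rewrite D0.
apply: null_all => x ux; have : D (usrc x) by rewrite DT.
by move=> [W nW [w Ww /usrcP wx]]; exists W => //; exists w;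
  rewrite ?wx ?src_unit.
Qed.

(** Two congruent functions of which one vanishes at a point [c] where the other
    is invertible.  Translating by a bisection through [c^-1] moves [c] to a
    unit; there both functions are locally constant, and a compression makes
    them multiples of a characteristic function, one of them zero. *)
Lemma exists_null : effective G -> forall f g c k, A f -> A g -> f ~ g ->
  k * f c = 1 -> g c = 0 -> exists2 U, null U & U !=set0.
Proof.
move=> effG f g c k Af Ag fg kfc gc.
have [B cB Bc] := exists_bisection (ginv c).
have AB : A (chi B) by exact: steinberg_set_charfun.
have [bB _] := cB.
pose f' := convolution (chi B) f; pose g' := convolution (chi B) g.
have shift h : convolution (chi B) h (src c) = h c.
  rewrite (charfun_convolution _ bB Bc) ?rng_inv ?rng_src//.
  by rewrite ginvK gmul_src.
have f'E : f' (src c) = f c by exact: shift.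
have g'E : g' (src c) = 0 by rewrite /g' shift.
have Af' : A f' by exact: steinberg_convolution.
have Ag' : A g' by exact: steinberg_convolution.
have near_const h : A h -> exists W, [/\ open W, W (src c) &
    forall x, W x -> h x = h (src c)].
  move=> /steinberg_continuous /(_ (src c) _ (discrete_set1 _)).
  by rewrite /= nbhsE => -[W [oW Wc] Wh]; exists W.
have [W1 [oW1 W1c f'c]] := near_const _ Af'.
have [W2 [oW2 W2c g'c]] := near_const _ Ag'.
pose V0 := units G `&` (W1 `&` W2).
have oV0 : open V0 by apply: openI; [exact: units_open|exact: openI].
have V00 : V0 !=set0 by exists (src c); split=> //; exact: src_in_units.
have [V1 [oV1 V10 V1V0 f'0]] :=
  compression_units effG Af' oV0 V00 (@subIsetl _ _ _).
have V1u : V1 `<=` units G by move=> x /V1V0[].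
have [V2 [oV2 [x V2x] V21 g'0]] := compression_units effG Ag' oV1 V10 V1u.
have [U [cU Ux UV2]] := basis_bisection oV2 V2x.
have UV1 := subset_trans UV2 V21.
have Uu := subset_trans UV1 V1u; have [[oU _ _] _] := cU.
have AU : A (chi U) by exact: steinberg_set_charfun.
(* on [U] and off the units, everything is as prescribed at [src c] *)
have compress h V :
    (forall c, V (src c) -> V (rng c) -> ~ units G c -> h c = 0) ->
    (forall x, U x -> h x = h (src c)) -> U `<=` V ->
    convolution (convolution (chi U) h) (chi U) =
      (fun x => h (src c) * chi U x).
  move=> h0 hc UV; apply/funext => a; rewrite compression//.
  have [ua|nua] := pselect (units G a).
    rewrite (src_unit ua) (rng_unit ua) andbb /charfun.
    by case: ifPn => [/set_mem/hc ->|]; rewrite (mulr1, mulr0).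
  rewrite [chi U a]charfun0 ?mulr0; last by move=> /Uu.
  by case: ifPn => // /andP[/set_mem/UV sa /set_mem/UV ra]; exact: h0.
have Uf : convolution (convolution (chi U) f') (chi U) =
          (fun x => f c * chi U x).
  rewrite (compress _ V1)// => [|y /UV1/V1V0[_ [+ _]]]; first by rewrite f'E.
  exact: f'c.
have Ug : convolution (convolution (chi U) g') (chi U) = 0.
  rewrite (compress _ V2)// => [|y /UV1/V1V0[_ [_ +]]]; last exact: g'c.
  by apply/funext => y; rewrite g'E mul0r.
exists U; last by exists x.
split=> //; have : convolution (fun a => k * chi U a)
      (convolution (convolution (chi U) f') (chi U)) ~
    convolution (fun a => k * chi U a)
      (convolution (convolution (chi U) g') (chi U)).
  apply: congruentMl; first exact: steinberg_scale.
  by apply: congruentMr => //; do 2!apply: congruentMl => //.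
rewrite Uf Ug convolution0r convolution_scalel;
  last exact: steinberg_rng_finite.
rewrite convolution_scaler; last exact: steinberg_rng_finite.
rewrite (_ : (fun _ => _) = chi U)//; apply/funext => y.
rewrite mulrA kfc mul1r charfun_units_convolution//; case: ifPn => // nUy.
rewrite charfun0// => Uy; move/negP: nUy; apply.
by rewrite inE (rng_unit (Uu _ Uy)).
Qed.

End SteinbergCongruence.
(** * Congruence-simplicity from the conditions on scalars and groupoid *)

Lemma congruence_simple_sufficient (G : hausdorffAmpleGroupoidType)
    (S : comNzSemiRingType) : [set: G] !=set0 ->
  is_field S \/ is_boolean_semifield S -> minimal G -> effective G ->
  congruence_simple (steinberg G S).
Proof.
move=> [a0 _] scalars minG effG; split.
  have [B cB Ba0] := exists_bisection a0.
  have AB : steinberg_set G S (charfun S B) by exact: steinberg_set_charfun.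
  exists (Steinberg (mem_set AB)) => /(congr1 (fun F => steinberg_fun F a0)) /=.
  by rewrite charfun1//; apply/eqP; exact: oner_neq0.
move=> rho rhoP.
have [[F [H [FH FneH]]]|no] :=
    pselect (exists F H, rho F H /\ F <> H :> (G -> S)); last first.
  left=> F H; split=> [FH|->]; last exact: congruence_refl.
  by apply: val_inj; apply: contrapT => ne; apply: no; exists F, H.
right; apply: (null_universal rhoP); apply: (minimal_null rhoP minG).
have [c Fc] : exists c, F c <> H c.
  apply: contrapT => no; apply: FneH; apply/funext => c.
  by apply: contrapT => ne; apply: no; exists c.
have AF := steinbergP F; have AH := steinbergP H.
have FHc : congruent rho F H by exists F, H.
have HFc := congruent_sym rhoP FHc.
case: scalars => [[opp inv]|[phi [psi phiK psiK]]].
  (* over a field, subtract [H] *)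
  have [m m1] := opp 1.
  have AmH := steinberg_scale m AH.
  have [_ AD _] := steinberg_set_subsemimodule G S.
  have cancelH x : H x + m * H x = 0.
    by rewrite -{1}[H x]mul1r -mulrDl m1 mul0r.
  have FHd : F c + m * H c <> 0.
    move=> e; apply: Fc; have := congr1 (fun s => s + H c) e.
    by rewrite add0r -addrA [m * _ + _]addrC cancelH addr0.
  have [k ck] := inv _ FHd.
  pose F' : G -> S := (F : G -> S) + (fun x => m * H x).
  apply: (@exists_null _ _ _ rhoP effG F' 0 c k).
  - exact: AD.
  - by have [] := steinberg_set_subsemimodule G S.
  - rewrite -[X in congruent _ _ X](_ : (H : G -> S) + (fun x => m * H x) = 0).
      by apply: congruentD => //; exact: congruent_refl.
    by apply/funext => x; exact: cancelH.
  - by rewrite mulrC.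
  - by [].
(* over the Boolean semifield, the two values are [0] and [1] *)
have val01 (s : S) : s = 0 \/ s = 1.
  have := phiK s; case: (phi s) => <-; [right|left].
    by have := phiK 1; rewrite rmorph1.
  by have := phiK 0; rewrite rmorph0.
have [Fc0|Fc1] := val01 (F c); have [Hc0|Hc1] := val01 (H c).
- by case: Fc; rewrite Fc0.
- by apply: (exists_null rhoP effG AH AF HFc (k := 1) (c := c)); rewrite ?mul1r.
- by apply: (exists_null rhoP effG AF AH FHc (k := 1) (c := c)); rewrite ?mul1r.
- by case: Fc; rewrite Fc1.
Qed.

(** * Commutative semirings with no proper congruence *)

Record scalar_congruence (S : comNzSemiRingType) (r : S -> S -> Prop) : Prop := {
  scalar_refl : forall a, r a a;
  scalar_sym : forall a b, r a b -> r b a;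
  scalar_trans : forall a b c, r a b -> r b c -> r a c;
  scalar_add : forall s a b, r a b -> r (s + a) (s + b);
  scalar_mul : forall s a b, r a b -> r (s * a) (s * b);
}.

Definition scalar_simple (S : comNzSemiRingType) : Prop :=
  forall r : S -> S -> Prop, scalar_congruence r ->
    (forall a b, r a b <-> a = b) \/ (forall a b, r a b).

Section SimpleScalars.
Variable S : comNzSemiRingType.
Hypothesis simpleS : scalar_simple S.
Implicit Types a b s t x y : S.

(** The congruence of equality after multiplication by [x] relates [1] to [0]
    only if [x = 0], so [x] is cancellable otherwise. *)
Lemma simple_cancel x a b : x <> 0 -> x * a = x * b -> a = b.
Proof.
move=> x0 xab.
have [|E|U] := @simpleS (fun a b => x * a = x * b).
- split=> //.
  + by move=> a' b' c -> ->.
  + by move=> s a' b' e; rewrite !mulrDr e.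
  + by move=> s a' b' e; rewrite ![x * (s * _)]mulrCA e.
- exact/E.
- by case: x0; have := U 1 0; rewrite mulr1 mulr0.
Qed.

(** The Bourne congruence of the ideal [x S] relates [x] to [0], so it relates
    [0] to [1] unless [x = 0]. *)
Lemma simple_bourne x : x <> 0 -> exists s t, 1 + x * s = x * t.
Proof.
move=> x0.
have [|E|U] := @simpleS (fun a b => exists s t, a + x * s = b + x * t).
- split.
  + by move=> a; exists 0, 0.
  + by move=> a b [s [t e]]; exists t, s.
  + move=> a b c [s [t e]] [s' [t' e']]; exists (s + s'), (t + t').
    by rewrite !mulrDr addrA e addrAC e' addrAC addrA.
  + by move=> u a b [s [t e]]; exists s, t; rewrite -!addrA e.
  + move=> u a b [s [t e]]; exists (u * s), (u * t).
    by rewrite ![x * (u * _)]mulrCA -!mulrDr e.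
- case: x0; apply/E; exists 0, 1; by rewrite mulr0 mulr1 addr0 add0r.
- by have [s [t e]] := U 1 0; exists s, t; rewrite e add0r.
Qed.

(** The additively invertible elements form an ideal that contains every summand
    of its elements.  By the Bourne relation [1 + x s = x t] it contains [1] as
    soon as it contains some [x <> 0]. *)
Lemma simple_opposite x y : x <> 0 -> x + y = 0 ->
  forall z : S, exists z', z + z' = 0.
Proof.
move=> x0 xy0 z; have [s [t e]] := simple_bourne x0.
exists (z * (x * s + y * t)).
by rewrite -{1}[z]mulr1 -mulrDr addrA e -mulrDl xy0 mul0r mulr0.
Qed.

Lemma simple_field : (forall x : S, exists y, x + y = 0) -> is_field S.
Proof.
move=> opp; split=> // x x0; have [s [t e]] := simple_bourne x0.
have [s' ss'] := opp s; exists (t + s').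
by rewrite mulrDr -e -addrA -mulrDr ss' mulr0 addr0.
Qed.

(** With neither nontrivial opposites nor zero divisors, [x |-> (x != 0)] is a
    homomorphism to the Boolean semifield; its kernel is a proper congruence,
    hence trivial. *)
Lemma simple_boolean : (forall x y : S, x + y = 0 -> x = 0) ->
  is_boolean_semifield S.
Proof.
move=> zsf; pose f x : boolean_semifield := x != 0.
have fD x y : f (x + y) = f x || f y.
  rewrite /f -negb_and; congr (~~ _); apply/eqP/andP => [xy|[/eqP-> /eqP->]].
    by split; apply/eqP; [exact: zsf xy|apply: (zsf y x); rewrite addrC].
  by rewrite addr0.
have fM x y : f (x * y) = f x && f y.
  rewrite /f -negb_or; congr (~~ _).
  apply/eqP/orP => [xy|[/eqP->|/eqP->]]; rewrite ?mul0r ?mulr0//.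
  have [_|/eqP x0] := boolP (x == 0); [by left|right].
  by apply/eqP; apply: (simple_cancel x0); rewrite mulr0.
have fI x y : f x = f y -> x = y.
  have [|E|U] := @simpleS (fun a b => f a = f b); last 2 first.
  - by move=> /E.
  - by have := U 1 0; rewrite /f eqxx oner_eq0.
  split=> //.
  + by move=> a b c -> ->.
  + by move=> s a b e; rewrite !fD e.
  + by move=> s a b e; rewrite !fM e.
have f0 : f 0 = 0 by rewrite /f eqxx.
have f1 : f 1 = 1 by rewrite /f oner_eq0.
pose phi : {rmorphism S -> boolean_semifield} := HB.pack f
  (GRing.isNmodMorphism.Build S boolean_semifield f (conj f0 fD))
  (GRing.isMonoidMorphism.Build S boolean_semifield f (f1, fM)).
exists phi.
exists (fun b : boolean_semifield => if b then 1 else 0) => [x|[]] /=.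
- by apply: fI; case E: (f x); [exact: f1|exact: f0].
- exact: f1.
- exact: f0.
Qed.

Lemma simple_classification : is_field S \/ is_boolean_semifield S.
Proof.
have [[x [y [x0 xy]]]|no] := pselect (exists x y : S, x <> 0 /\ x + y = 0).
  by left; apply: simple_field; exact: simple_opposite xy.
right; apply: simple_boolean => x y xy.
by apply: contrapT => x0; apply: no; exists x, y.
Qed.

End SimpleScalars.
(** * Congruences attached to scalars, to invariant sets and to isotropy *)

Section PointwiseCongruence.
Variables (G : hausdorffAmpleGroupoidType) (S : comNzSemiRingType).
Variables (r : S -> S -> Prop) (E : set G).
Hypothesis rP : scalar_congruence r.
Hypothesis E_factor : forall a b, src a = rng b -> E (gmul a b) -> E a /\ E b.
Implicit Types (f g h : G -> S) (c : G).

Lemma scalar_congruenceD (x y x' y' : S) : r x y -> r x' y' ->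
  r (x + x') (y + y').
Proof.
move=> xy xy'; apply: (scalar_trans rP (b := x + y')).
  exact: scalar_add.
by rewrite ![_ + y']addrC; exact: scalar_add.
Qed.

Lemma convolution_related f f' h h' c : rng_finite f -> rng_finite f' ->
  (forall a b, src a = rng b -> gmul a b = c -> r (f a * h b) (f' a * h' b)) ->
  r (convolution f h c) (convolution f' h' c).
Proof.
move=> Ff Ff' fh.
pose fiber := [set ab : G * G | composable G ab /\ gmul ab.1 ab.2 = c].
pose D := (fiber `&` [set ab | f ab.1 <> 0]) `|`
          (fiber `&` [set ab | f' ab.1 <> 0]).
have finD : finite_set D by rewrite finite_setU; split; exact: fiber_finite.
have Dc : D `<=` fiber by move=> ab [[]|[]].
rewrite (@convolutionE _ _ f h c D)//; last by move=> ab; left.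
rewrite (@convolutionE _ _ f' h' c D)//; last by move=> ab; right.
rewrite !fsbig_finite//= big_seq [X in r _ X]big_seq.
apply: (big_ind2 r); [exact: scalar_refl|exact: scalar_congruenceD|].
move=> [a b]; rewrite in_fset_set// => /set_mem/Dc[ab abc]; exact: fh.
Qed.

(** Comparing values modulo [r] on a set [E] of arrows is compatible with
    convolution as soon as the factors of an arrow of [E] lie in [E]. *)
Lemma pointwise_congruence :
  congruence (fun F H : steinberg G S => forall c, E c -> r (F c) (H c)).
Proof.
have RF (F : steinberg G S) : rng_finite F.
  exact: steinberg_rng_finite (steinbergP F).
split=> [F c _|F H FH c Ec|F H K FH HK c Ec|K F H FH c Ec|K F H FH c Ec|
    K F H FH c Ec].
- exact: scalar_refl.
- by apply: scalar_sym => //; exact: FH.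
- by apply: (scalar_trans rP (b := H c)); [exact: FH|exact: HK].
- by apply: scalar_add => //; exact: FH.
- apply: (convolution_related (RF K) (RF K)) => a b ab abc.
  have [_ Eb] := E_factor ab (eq_ind_r E Ec abc).
  by apply: scalar_mul => //; exact: FH.
- apply: (convolution_related (RF F) (RF H)) => a b ab abc.
  have [Ea _] := E_factor ab (eq_ind_r E Ec abc).
  by rewrite ![_ * K b]mulrC; apply: scalar_mul => //; exact: FH.
Qed.

End PointwiseCongruence.

Section OrbitCongruence.
Variables (G : hausdorffAmpleGroupoidType) (S : comNzSemiRingType).
Implicit Types (U V : set G) (a b c : G) (f g h phi : G -> S).

Local Notation A := (steinberg_set G S).
Local Notation chi := (charfun S).

(** A function on the unit space, seen as a function of the range of an arrow.
    Convolution makes these functions a module over the Steinberg algebra. *)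
Definition range_function phi := forall c, phi c = phi (rng c).

Lemma convolution_range_function h phi : A h -> range_function phi ->
  range_function (convolution h phi).
Proof.
move=> Ah phiP.
suff : A `<=` [set h | A h /\ range_function (convolution h phi)].
  by move=> /(_ _ Ah)[].
have [A0 AD AZ] := steinberg_set_subsemimodule G S.
have RF := steinberg_rng_finite.
move=> {h Ah}; apply: steinberg_set_ind => [|U cU].
  split=> [|h h' [Ah Ph] [Ah' Ph']|k h [Ah Ph]]; split=> //.
  - by move=> c; rewrite convolution0l.
  - exact: AD.
  - by move=> c; rewrite convolution_addl; [|exact: RF|exact: RF];
      congr (_ + _); [exact: Ph|exact: Ph'].
  - exact: AZ.
  - move=> c; rewrite convolution_scalel; last exact: RF.
    by congr (_ * _); exact: Ph.
have [bU _] := cU; split; first exact: steinberg_set_charfun.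
move=> c; have [[a [Ua ac]]|no] := pselect (exists a, U a /\ rng a = rng c).
  rewrite !(charfun_convolution _ bU Ua) ?rng_rng//.
  rewrite phiP rng_mul ?src_inv// [RHS]phiP rng_mul ?src_inv ?rng_rng//.
have nU a : U a -> rng a <> rng c by move=> Ua ac; apply: no; exists a.
by rewrite !charfun_convolution0// => a Ua; rewrite rng_rng; exact: nU.
Qed.

(** Here [phi] need not belong to the algebra.  By linearity [f] and [h] are
    characteristic functions of bisections, and then both sides evaluate [phi]
    at the same translate of the argument. *)
Lemma convolutionA_module f h phi : A f -> A h ->
  convolution f (convolution h phi) = convolution (convolution f h) phi.
Proof.
move=> Af Ah; have [A0 AD AZ] := steinberg_set_subsemimodule G S.
have RF := steinberg_rng_finite; have AC := steinberg_convolution.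
suff : A `<=` [set f | A f /\
    convolution f (convolution h phi) = convolution (convolution f h) phi].
  by move=> /(_ _ Af)[].
move=> {f Af}; apply: steinberg_set_ind => [|U cU].
  split=> [|f g [Af Pf] [Ag Pg]|k f [Af Pf]]; split=> //.
  - by rewrite !convolution0l.
  - exact: AD.
  - rewrite !(convolution_addl _ (RF _ _ _ Af) (RF _ _ _ Ag)) Pf Pg.
    by rewrite convolution_addl//; apply: RF; exact: AC.
  - exact: AZ.
  - rewrite !(convolution_scalel _ _ (RF _ _ _ Af)) Pf.
    by rewrite convolution_scalel//; apply: RF; exact: AC.
have AU : A (chi U) by exact: steinberg_set_charfun.
have FU := RF _ _ _ AU; split=> //.
suff : A `<=` [set h | A h /\ convolution (chi U) (convolution h phi) =
    convolution (convolution (chi U) h) phi] by move=> /(_ _ Ah)[].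
move=> {h Ah}; apply: steinberg_set_ind => [|V cV].
  split=> [|h g [Ah Ph] [Ag Pg]|k h [Ah Ph]]; split=> //.
  - by rewrite convolution0l convolution0r convolution0l.
  - exact: AD.
  - rewrite (convolution_addl _ (RF _ _ _ Ah) (RF _ _ _ Ag)).
    rewrite !(convolution_addr _ _ FU) Ph Pg.
    by rewrite convolution_addl//; apply: RF; exact: AC.
  - exact: AZ.
  - rewrite (convolution_scalel _ _ (RF _ _ _ Ah)) !(convolution_scaler _ _ FU).
    by rewrite Ph convolution_scalel//; apply: RF; exact: AC.
split; first exact: steinberg_set_charfun.
have [[bU _] [bV _]] := (cU, cV); have [bUV _] := set_mul_bisection cU cV.
rewrite convolution_charfun//; apply/funext => c.
have [[a [Ua ac]]|no] := pselect (exists a, U a /\ rng a = rng c); last first.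
  have nU a : U a -> rng a <> rng c by move=> Ua ac; apply: no; exists a.
  rewrite !charfun_convolution0// => _ [a [b [Ua _ ab ->]]].
  by rewrite rng_mul//; exact: nU.
have rd : src (ginv a) = rng c by rewrite src_inv.
rewrite (charfun_convolution _ bU Ua)//.
have [[b [Vb ba]]|no] := pselect (exists b, V b /\ rng b = src a).
  have UVab : set_mul U V (gmul a b) by exists a, b.
  rewrite (charfun_convolution _ bV Vb) ?rng_mul ?rng_inv//.
  rewrite (charfun_convolution _ bUV UVab) ?rng_mul//; congr phi.
  have abc : src (ginv (gmul a b)) = rng c by rewrite src_inv rng_mul.
  apply: (@gmulI _ (gmul a b)).
  - by rewrite rng_mul ?rng_inv ?src_mul// src_inv rng_mul ?rng_inv.
  - by rewrite rng_mul ?rng_inv.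
  - rewrite [RHS]gmulVK ?rng_mul// -gmulA//; last first.
      by rewrite rng_mul ?rng_inv// src_inv rng_mul ?rng_inv.
    by rewrite gmulVK ?rng_mul ?rng_inv// gmulVK.
rewrite !charfun_convolution0//.
  move=> _ [a' [b [Ua' Vb ab ->]]]; rewrite rng_mul// => ac'.
  have aa' : a' = a by apply: (bisection_rngI bU) => //; rewrite ac' ac.
  by apply: no; exists b; rewrite -ab aa'.
by move=> b Vb; rewrite rng_mul// rng_inv => ba; apply: no; exists b.
Qed.

(** The kernel of the representation of the algebra on functions of units. *)
Lemma orbit_congruence : congruence (fun F H : steinberg G S =>
  forall phi, range_function phi -> convolution F phi = convolution H phi).
Proof.
have AF (F : steinberg G S) := steinbergP F.
have RF (F : steinberg G S) := steinberg_rng_finite (AF F).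
split=> [//|F H FH phi phiP|F H K FH HK phi phiP|K F H FH phi phiP|
  K F H FH phi phiP|K F H FH phi phiP].
- by rewrite FH.
- by rewrite FH// HK.
- rewrite (convolution_addl _ (RF K) (RF F)).
  by rewrite (convolution_addl _ (RF K) (RF H)) FH.
- rewrite -[LHS](convolutionA_module _ (AF K) (AF F)).
  by rewrite -[RHS](convolutionA_module _ (AF K) (AF H)) FH.
- rewrite -[LHS](convolutionA_module _ (AF F) (AF K)).
  rewrite -[RHS](convolutionA_module _ (AF H) (AF K)) FH//.
  exact: convolution_range_function.
Qed.

End OrbitCongruence.

(** * Conditions forced by congruence-simplicity *)

Section Necessity.
Variables (G : hausdorffAmpleGroupoidType) (S : comNzSemiRingType).
Hypothesis G_nonempty : [set: G] !=set0.
Hypothesis simpleA : congruence_simple (steinberg G S).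
Implicit Types (U V : set G) (a b c : G).

Definition steinberg_char U (cU : compact_open_bisections G U) : steinberg G S :=
  Steinberg (mem_set (@steinberg_set_charfun G S U cU)).

Lemma simple_scalars : scalar_simple S.
Proof.
move=> r rP; have [_ simple] := simpleA; have [a0 _] := G_nonempty.
have [B cB Ba0] := exists_bisection a0.
pose K (x : S) : steinberg G S :=
  Steinberg (mem_set (steinberg_scale x (@steinberg_set_charfun G S B cB))).
have KE x c : B c -> K x c = x by move=> Bc; rewrite /= charfun1 ?mulr1.
have KN x c : ~ B c -> K x c = 0 by move=> Bc; rewrite /= charfun0 ?mulr0.
have [//|E|U] := simple _ (@pointwise_congruence G S r setT rP _).
- left=> x y; split=> [xy|->]; last exact: scalar_refl.
  have /E/(congr1 (fun F => steinberg_fun F a0)) :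
      forall c, setT c -> r (K x c) (K y c).
    move=> c _; have [Bc|Bc] := pselect (B c); first by rewrite !KE.
    by rewrite !KN//; exact: scalar_refl.
  by rewrite -/(K x a0) -/(K y a0) !KE.
- by right=> x y; have := U (K x) (K y) a0 I; rewrite !KE.
Qed.

(** Agreement at the arrows whose source is outside the invariant set [D] is a
    congruence.  It ignores the functions supported over [D], so it is trivial
    only if [D] is empty; it is universal only if [D] contains every unit. *)
Lemma simple_minimal : minimal G.
Proof.
move=> D oD iD; have [_ simple] := simpleA.
have iDV b : D (urng b) -> D (usrc b).
  have -> : urng b = usrc (ginv b) by apply: val_inj; rewrite /= src_inv.
  move=> /iD; congr D; apply: val_inj; by rewrite /= rng_inv.
pose E c := ~ D (usrc c).
have Efactor a b : src a = rng b -> E (gmul a b) -> E a /\ E b.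
  move=> ab; have -> : E (gmul a b) = E b.
    by congr (~ D _); apply: val_inj; rewrite /= src_mul.
  move=> Eb; split=> //; have -> : E a = (~ D (urng b)); last by move/iDV.
  by congr (~ D _); apply: val_inj.
have eqS : scalar_congruence (@eq S).
  by split=> // [? ? ? -> //|? ? ? -> //|? ? ? -> //].
have unitE (x : units G) : usrc (val x) = x.
  by apply: val_inj; rewrite /= src_unit//; case: x => x /= /set_mem.
have [diag|univ] := simple _ (pointwise_congruence eqS Efactor).
  left; rewrite -subset0 => x Dx.
  have oW : open (@usrc G @^-1` D).
    by have /continuousP := @usrc_continuous G; apply.
  have Wx : (@usrc G @^-1` D) (val x) by rewrite /= unitE.
  have [B [cB Bx BW]] := basis_bisection oW Wx.
  have /diag/(congr1 (fun F => steinberg_fun F (val x))) :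
      forall c, E c -> steinberg_char cB c = (0 : steinberg G S) c.
    by move=> c Ec; apply: charfun0 => /BW.
  by rewrite /= charfun1//; apply/eqP; rewrite oner_eq0.
right; apply/seteqP; split=> // x _; apply: contrapT => nDx.
have [B cB Bx] := exists_bisection (val x).
have := univ (steinberg_char cB) 0 (val x); rewrite /E unitE => /(_ nDx) /=.
by rewrite charfun1//; apply/eqP; rewrite oner_eq0.
Qed.

(** If a bisection [B] consists of isotropy, then [B] and [src @` B] act in the
    same way on functions of units, so faithfulness makes them equal. *)
Lemma simple_effective : effective G.
Proof.
rewrite /effective -subset0 => x; rewrite /interior nbhsE /= => -[W [oW Wx] WI].
have [B [cB Bx BW]] := basis_bisection oW Wx; have [bB _] := cB.
have csB := src_image_bisection cB; have [bsB _] := csB.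
have [_ simple] := simpleA.
have [diag|univ] := simple _ (@orbit_congruence G S).
  have : steinberg_char cB = steinberg_char csB.
    apply/diag => phi phiP; apply/funext => c.
    have [[a [Ba ac]]|no] := pselect (exists a, B a /\ rng a = rng c).
      have [sra _] := WI _ (BW _ Ba).
      have sBa : (@src G @` B) (src a) by exists a.
      rewrite (charfun_convolution _ bB Ba)// (charfun_convolution _ bsB sBa).
        rewrite [LHS]phiP [RHS]phiP.
        rewrite !rng_mul ?src_inv ?rng_inv ?rng_src ?src_src//.
        by rewrite sra.
      by rewrite rng_src sra.
    rewrite !charfun_convolution0// => [_ [a Ba <-]|a Ba] ac; apply: no;
      exists a; split=> //.
    by have [sra _] := WI _ (BW _ Ba); rewrite -ac rng_src sra.
  move=> /(congr1 (fun F => steinberg_fun F x)) /=; rewrite charfun1//.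
  rewrite charfun0; first by apply/eqP; rewrite oner_eq0.
  by move=> [a _ ax]; have [_] := WI _ Wx; apply; rewrite -ax;
    exact: src_in_units.
have := univ (steinberg_char cB) 0 (fun=> 1) (fun=> erefl).
move=> /(congr1 (fun f => f (rng x))); rewrite /= convolution0l.
by rewrite (charfun_convolution _ bB Bx) ?rng_rng//; apply/eqP;
  rewrite oner_eq0.
Qed.

End Necessity.

Theorem theorem3p5 (G : hausdorffAmpleGroupoidType) (S : comNzSemiRingType)
    (G_nonempty : [set: G] !=set0) :
  congruence_simple (steinberg G S) <->
  (is_field S \/ is_boolean_semifield S) /\ (minimal G /\ effective G).
Proof.
split=> [simpleA|[scalars [minG effG]]].
  split; first exact/simple_classification/(simple_scalars G_nonempty simpleA).
  by split; [exact: simple_minimal simpleA|exact: simple_effective simpleA].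
exact: congruence_simple_sufficient.
Qed.
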